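(* Let $n\ge 1$ and $r\ge 2$. If the variety $C_r(\mathcal{N}_n)$ is irreducible, then for every $(x_1,\ldots,x_r)\in C_r(\mathcal{N}_n)$ the commutative subalgebra $k\langle x_1,\ldots,x_r\rangle$ of $\mathfrak{gl}_n$ generated by $x_1,\ldots,x_r$ has dimension at most $n-1$ over $k$.
   Context: $k$ is an algebraically closed field, $\mathfrak{gl}_n$ is the space of $n\times n$ matrices over $k$, and $\mathcal{N}_n\subset\mathfrak{gl}_n$ is the closed subvariety of nilpotent matrices. $C_r(\mathcal{N}_n)=\{(v_1,\ldots,v_r)\in(\mathcal{N}_n)^r : [v_i,v_j]=0 \text{ for all } i,j\}$, with the Zariski topology; irreducible means irreducible as a topological space. For pairwise commuting matrices $x_1,\ldots,x_r$, $k\langle x_1,\ldots,x_r\rangle$ denotes the commutative associative matrix algebra without unity generated by them, i.e. the $k$-span of all monomials of positive degree in $x_1,\ldots,x_r$. *)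

(* Defs.v *)
From mathcomp Require Import all_boot all_order all_algebra.
From mathcomp.multinomials Require Export mpoly.

Set Implicit Arguments.
Unset Strict Implicit.
Unset Printing Implicit Defensive.

Import GRing.Theory.
Local Open Scope ring_scope.

(* r-tuples of n x n matrices, i.e. the closed points of the affine space of
   dimension r * n^2. *)
Definition mxtuple (k : fieldType) (n r : nat) := {ffun 'I_r -> 'M[k]_n}.

Definition mxbracket (k : fieldType) (n : nat) (A B : 'M[k]_n) : 'M[k]_n :=
  A *m B - B *m A.

Definition nilpotent_mx (k : fieldType) (n : nat) (A : 'M[k]_n) : Prop :=
  exists m : nat, A ^+ m = 0.

Definition nilcomm (k : fieldType) (n r : nat) (x : mxtuple k n r) : Prop :=
  (forall i, nilpotent_mx (x i)) /\ (forall i j, mxbracket (x i) (x j) = 0).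

Definition coord_index (n r : nat) : finType := ('I_r * 'I_n * 'I_n)%type.

(* The coordinate numbered c is the (i, j) entry of the l-th matrix, where
   (l, i, j) is the c-th element of coord_index n r. *)
Definition mxcoord (k : fieldType) (n r : nat) (x : mxtuple k n r)
    (c : 'I_#|coord_index n r|) : k :=
  let: (l, i, j) := enum_val c in x l i j.

Definition zero_locus (k : fieldType) (n r : nat)
    (S : {mpoly k[#|coord_index n r|]} -> Prop) (x : mxtuple k n r) : Prop :=
  forall p, S p -> p.@[mxcoord x] = 0.

(* Closed subsets of X for the topology induced on X by the Zariski topology
   of the ambient affine space. *)
Definition zariski_closed_in (k : fieldType) (n r : nat)
    (X Z : mxtuple k n r -> Prop) : Prop :=
  exists S : {mpoly k[#|coord_index n r|]} -> Prop,
    forall x, Z x <-> X x /\ zero_locus S x.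

(* Nonempty, and not the union of two proper closed subsets. *)
Definition zariski_irreducible (k : fieldType) (n r : nat)
    (X : mxtuple k n r -> Prop) : Prop :=
  (exists x, X x) /\
  forall Z1 Z2 : mxtuple k n r -> Prop,
    zariski_closed_in X Z1 -> zariski_closed_in X Z2 ->
    (forall x, X x -> Z1 x \/ Z2 x) ->
    (forall x, X x -> Z1 x) \/ (forall x, X x -> Z2 x).

(* The factors are taken in increasing order of the index, which is immaterial
   when the matrices commute. *)
Definition mx_monomial (k : fieldType) (n r : nat) (x : mxtuple k n r)
    (m : 'X_{1..r}) : 'M[k]_n :=
  \prod_(i < r) x i ^+ m i.

(* k<x_1, ..., x_r>, the algebra without unity generated by commuting x_i. *)
Definition nonunital_alg (k : fieldType) (n r : nat) (x : mxtuple k n r)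
    (y : 'M[k]_n) : Prop :=
  exists s : seq 'X_{1..r},
    all (fun m => 0 < mdeg m)%N s /\ y \in <<[seq mx_monomial x m | m <- s]>>%VS.

(* Main.v *)
(* C_r(N_n) is covered by the closed sets x_1^(n-1) = 0 and "all n x n minors of
   given n monomials vanish": if x_1^(n-1) <> 0, pick v with v x_1^(n-1) <> 0;
   v is cyclic, so an element y of the commutant of x_1 is determined by v y,
   and for y a monomial of positive degree, v y lies in the kernel of x_1^(n-1),
   which is a proper subspace. A regular nilpotent x_1 shows that the first
   closed set is proper, so by irreducibility the second one is everything. *)
Require Import Defs.
From mathcomp Require Import all_boot all_order all_algebra.
From mathcomp.multinomials Require Import mpoly.
From mathcomp Require Import zify.

Set Implicit Arguments.
Unset Strict Implicit.
Unset Printing Implicit Defensive.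

Import GRing.Theory.
Local Open Scope ring_scope.

(** * Nilpotent matrices and cyclic vectors *)

(** The minimal polynomial divides a power of ['X], so it is associate to some ['X^d]; it also
    divides the characteristic polynomial, which forces [d <= n]. *)
Lemma nilpotent_expn (k : fieldType) (n : nat) (A : 'M[k]_n) :
  nilpotent_mx A -> A ^+ n = 0.
Proof.
case: n A => [|n] A [m Am0]; first by rewrite [LHS]flatmx0 [RHS]flatmx0.
have : mxminpoly A %| ('X - 0%:P) ^+ m.
  by rewrite dvd_mxminpoly subr0 rmorphXn /= horner_mx_X Am0.
case/dvdp_exp_XsubCP => d _; rewrite subr0 => eqd.
have sz := eqp_size eqd; rewrite size_polyXn in sz.
have led : (d <= n.+1)%N.
  have := dvdp_leq _ (mxminpoly_dvd_char A).
  by rewrite monic_neq0 ?char_poly_monic // size_char_poly sz; apply.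
have Ad0 : A ^+ d = 0.
  apply/eqP; have := eqp_dvdl 'X^d eqd; rewrite dvdpp dvd_mxminpoly.
  by rewrite rmorphXn /= horner_mx_X.
by rewrite -[LHS](congr1 (GRing.exp A) (subnK led)) exprD Ad0 mulr0.
Qed.

(** In a relation among the [v *m A ^+ i], multiplying by [A ^+ (n.-1 - i)] kills every term above
    [i]; those below [i] are gone by induction, so the coefficient at [i] vanishes. *)
Lemma krylov_free (k : fieldType) (n : nat) (A : 'M[k]_n) (v : 'rV[k]_n) :
  A ^+ n = 0 -> v *m A ^+ n.-1 != 0 ->
  row_free (\matrix_(i < n) (v *m A ^+ i)).
Proof.
move=> An0 vA; rewrite -kermx_eq0; apply/rowV0P => u /sub_kermxP.
rewrite mulmx_sum_row => u0.
have Abig a : (n <= a)%N -> A ^+ a = 0 by move/subnK <-; rewrite exprD An0 mulr0.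
suff H : forall (m : nat) (i : 'I_n), (i < m)%N -> u 0 i = 0.
  by apply/rowP => i; rewrite mxE (H n).
elim=> // m IHm i; rewrite ltnS leq_eqVlt => /orP[/eqP im|]; last exact: IHm.
have /(congr1 (mulmxr (A ^+ (n.-1 - i)))) /= := u0.
rewrite mul0mx mulmx_suml (bigD1 i) //= big1 => [|j /negP jNi].
  rewrite addr0 -scalemxAl rowK -mulmxA mulmxE -exprD subnKC.
    by move/eqP; rewrite scaler_eq0 (negPf vA) orbF => /eqP.
  by rewrite -ltnS prednK ?ltn_ord // (leq_trans _ (ltn_ord i)).
rewrite -scalemxAl rowK -mulmxA mulmxE -exprD.
case: (ltngtP j i) => [ji|ij|/val_inj] //.
- by rewrite (IHm j) ?scale0r // -im.
- rewrite Abig ?mulmx0 ?scaler0 //.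
  by move: (ltn_ord i) ij; lia.
- by move=> ij; case: jNi; apply/eqP.
Qed.

Section CyclicVector.
Variables (k : fieldType) (n : nat) (A : 'M[k]_n) (v : 'rV[k]_n).
Hypotheses (An0 : A ^+ n = 0) (vA : v *m A ^+ n.-1 != 0).

(** Each row [v *m A ^+ i] of the invertible Krylov matrix is killed by [B], since [B] can be moved
    next to [v]. *)
Lemma comm_cyclic_eq0 (B : 'M[k]_n) : GRing.comm A B -> v *m B = 0 -> B = 0.
Proof.
move=> cAB vB; have := krylov_free An0 vA; rewrite row_free_unit => Pu.
rewrite -[B](mulKmx Pu) (_ : _ *m B = 0) ?mulmx0 //.
apply/row_matrixP => i; rewrite row_mul rowK row0 -mulmxA mulmxE.
by rewrite -(commrX i (commr_sym cAB)) -mulmxE mulmxA vB mul0mx.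
Qed.

(* The line spanned by v A^(n-1) is the row kernel of A, hence stable under B,
   hence killed by B. *)
Lemma comm_nilpotent_kill (B : 'M[k]_n) :
  GRing.comm A B -> nilpotent_mx B -> v *m A ^+ n.-1 *m B = 0.
Proof.
move=> cAB [m Bm0]; have := krylov_free An0 vA; rewrite row_free_unit => Pu.
set w := v *m A ^+ n.-1.
have n0 : (0 < n)%N.
  by case: posnP => // n0; case/eqP: vA; move: v A n0 => v' A' n0; subst n; apply/rowP; case.
(* Coordinates of [v *m B] in the Krylov basis. Multiplication by [A ^+ n.-1] leaves only the one at
   index 0, which is thus the eigenvalue of [B] on [w]. *)
pose u := v *m B *m invmx (\matrix_(i < n) (v *m A ^+ i)).
have wB : w *m B = u 0 (Ordinal n0) *: w.
  rewrite -mulmxA mulmxE -(commrX _ (commr_sym cAB)) -mulmxE mulmxA.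
  rewrite -[v *m B](mulmxKV Pu) -/u [u *m _]mulmx_sum_row mulmx_suml (bigD1 (Ordinal n0)) //=.
  rewrite -scalemxAl rowK expr0 mulmx1 big1 ?addr0 // => j /negP jN0.
  rewrite -scalemxAl rowK -mulmxA mulmxE -exprD (_ : A ^+ _ = 0) ?mulmx0 ?scaler0 //.
  have j0 : (0 < j)%N by rewrite lt0n; apply/negP => /eqP j0; apply: jN0; apply/eqP/val_inj.
  have le : (n <= j + n.-1)%N by rewrite -{1}(prednK n0) -add1n leq_add2r.
  by rewrite -(subnK le) exprD An0 mulr0.
have wBm a : w *m B ^+ a = u 0 (Ordinal n0) ^+ a *: w.
  elim: a => [|a IHa]; first by rewrite !expr0 mulmx1 scale1r.
  by rewrite !exprSr -mulmxE mulmxA IHa -scalemxAl wB scalerA.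
have := wBm m; rewrite Bm0 mulmx0 => /esym/eqP.
rewrite scaler_eq0 (negPf vA) orbF expf_eq0 => /andP[_ /eqP u0].
by rewrite wB u0 scale0r.
Qed.

End CyclicVector.

(** * Monomials in commuting nilpotent matrices *)

Lemma nilcomm_comm (k : fieldType) (n r : nat) (x : mxtuple k n r) :
  nilcomm x -> forall i j, GRing.comm (x i) (x j).
Proof. by case=> _ cx i j; apply/eqP; rewrite -subr_eq0; apply/eqP/cx. Qed.

(** The first factor with a positive exponent kills [w]; the factors before it are identities. *)
Lemma monomial_kill (k : fieldType) (n r : nat) (x : mxtuple k n r)
    (w : 'rV[k]_n) (m : 'X_{1..r}) :
  (forall i, w *m x i = 0) -> (0 < mdeg m)%N -> w *m mx_monomial x m = 0.
Proof.
move=> wx m0; have /existsP[i mi] : [exists i, m i != 0%N].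
  rewrite -[[exists _, _]]negbK negb_exists; apply: contraL m0 => /forallP m0.
  by rewrite -eqn0Ngt mdegE big1 // => i _; apply/eqP; rewrite -[_ == _]negbK m0.
have : i \in index_enum 'I_r by rewrite mem_index_enum.
rewrite /mx_monomial; elim: (index_enum _) => //= j s IHs.
rewrite big_cons -mulmxE mulmxA inE.
case E: (m j) => [|a] => [|_]; last by rewrite exprS -mulmxE mulmxA wx !mul0mx.
by rewrite expr0 mulmx1; case: eqP => [ij|_]; [rewrite ij E in mi | exact: IHs].
Qed.

(** By pigeonhole some exponent is at least [n], and the corresponding power is zero. *)
Lemma monomial_big_eq0 (k : fieldType) (n r : nat) (x : mxtuple k n r)
    (m : 'X_{1..r}) :
  nilcomm x -> (r * n < mdeg m)%N -> mx_monomial x m = 0.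
Proof.
move=> [nx _] mbig; have /existsP[i mi] : [exists i, (n <= m i)%N].
  rewrite -[[exists _, _]]negbK negb_exists; apply: contraL mbig => /forallP mn.
  rewrite -leqNgt mdegE -[r in (_ <= r * _)%N]card_ord -sum_nat_const leq_sum // => i _.
  by rewrite ltnW // ltnNge mn.
rewrite /mx_monomial; case: (splitPr (mem_index_enum i)) => s1 s2.
rewrite big_cat big_cons /= -(subnK mi) exprD nilpotent_expn // mulr0.
by rewrite mul0r mulr0.
Qed.

Lemma monomials_dependent (k : fieldType) (n r : nat) (x : mxtuple k n r)
    (l : 'I_r) (m : 'I_n -> 'X_{1..r}) :
  nilcomm x -> x l ^+ n.-1 != 0 -> (forall i, 0 < mdeg (m i))%N ->
  exists2 c : 'rV[k]_n, c != 0 & \sum_i c 0 i *: mx_monomial x (m i) = 0.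
Proof.
move=> hx xl m0; have cx := nilcomm_comm hx; have nx := hx.1.
(* A nonzero vector of the row space of [x l ^+ n.-1], written as [v *m x l ^+ n.-1]; this [v] is
   cyclic. *)
have /rowV0Pn[_ /submxP[v ->] va] := xl.
have xl0 := nilpotent_expn (nx l).
have cm j : GRing.comm (x l) (mx_monomial x (m j)).
  by apply: commr_prod => i _; apply: commrX.
pose Q := \matrix_i (v *m mx_monomial x (m i)).
have QA : Q *m x l ^+ n.-1 = 0.
  apply/row_matrixP => i; rewrite row_mul rowK row0 -mulmxA mulmxE.
  rewrite (commrX _ (commr_sym (cm i))) -mulmxE mulmxA.
  by apply: monomial_kill => // j; apply: comm_nilpotent_kill.
(* [Q] is not invertible, because it annihilates the nonzero [x l ^+ n.-1]. A relation among its
   rows gives a combination of monomials killing [v]. *)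
have : kermx Q != 0.
  rewrite kermx_eq0 row_free_unit; apply: contra xl => Qu.
  by rewrite -(mulKmx Qu (x l ^+ _)) QA mulmx0.
case/rowV0Pn => c /sub_kermxP cQ cN0; exists c => //.
apply: (comm_cyclic_eq0 xl0 va).
  apply: commr_sum => i _.
  by rewrite /GRing.comm -!mulmxE -scalemxAr -scalemxAl !mulmxE cm.
move: cQ; rewrite mulmx_sum_row mulmx_sumr; apply: etrans.
by apply: eq_bigr => i _; rewrite rowK scalemxAr.
Qed.

(** * Polynomial equations in the matrix entries *)

(** The entries are the coordinate functions, so entries and minors of expressions in these matrices
    are polynomials that can define closed sets. *)
Definition generic_mx (k : fieldType) (n r : nat) (l : 'I_r) :
    'M[{mpoly k[#|coord_index n r|]}]_n :=
  \matrix_(i, j) 'X_(enum_rank (l, i, j) : 'I_#|coord_index n r|).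

Definition generic_monomial (k : fieldType) (n r : nat) (m : 'X_{1..r}) :
    'M[{mpoly k[#|coord_index n r|]}]_n :=
  \prod_(i < r) generic_mx k n i ^+ m i.

Lemma map_mx_exp (aR rR : pzSemiRingType) (f : {rmorphism aR -> rR}) (n : nat)
    (A : 'M[aR]_n) (a : nat) : map_mx f (A ^+ a) = map_mx f A ^+ a.
Proof.
elim: a => [|a IHa]; first by rewrite !expr0 map_mx1.
by rewrite !exprS -!mulmxE map_mxM IHa.
Qed.

Lemma meval_generic_mx (k : fieldType) (n r : nat) (x : mxtuple k n r) l :
  map_mx (meval (mxcoord x)) (generic_mx k n l) = x l.
Proof. by apply/matrixP => i j; rewrite !mxE mevalXU /mxcoord enum_rankK. Qed.

Lemma meval_generic_monomial (k : fieldType) (n r : nat) (x : mxtuple k n r) m :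
  map_mx (meval (mxcoord x)) (generic_monomial k n m) = mx_monomial x m.
Proof.
rewrite /generic_monomial /mx_monomial.
elim: (index_enum _) => [|i s IHs]; first by rewrite !big_nil map_mx1.
by rewrite !big_cons -!mulmxE map_mxM IHs map_mx_exp meval_generic_mx.
Qed.

(** A single nilpotent Jordan block, shifting the standard row vectors forward. *)
Definition regular_nilpotent (k : fieldType) (n : nat) : 'M[k]_n :=
  \matrix_(i, j) (j == i.+1 :> nat)%:R.

Lemma regular_nilpotent_exp (k : fieldType) (n a : nat) :
  regular_nilpotent k n ^+ a = \matrix_(i, j) (j == (i + a)%N :> nat)%:R.
Proof.
elim: a => [|a IHa].
  by apply/matrixP => i j; rewrite expr0 !mxE addn0 eq_sym.
rewrite exprSr IHa -mulmxE; apply/matrixP => i j; rewrite !mxE.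
have [lt|ge] := ltnP (i + a) n.
  rewrite (bigD1 (Ordinal lt)) //= !mxE eqxx mul1r addnS big1 ?addr0 // => l /negPf lN.
  by rewrite !mxE -[l == _ :> nat]/(l == Ordinal lt) lN mul0r.
rewrite big1 => [|l _]; last by rewrite !mxE ltn_eqF ?mul0r // (leq_trans _ ge).
by rewrite ltn_eqF // addnS ltnS (leq_trans _ ge) // ltnW.
Qed.

Lemma nilcomm_regular (k : fieldType) (n r : nat) (l : 'I_r) : (0 < n)%N ->
  exists2 x : mxtuple k n r, nilcomm x & x l ^+ n.-1 != 0.
Proof.
move=> n0; exists [ffun i => if i == l then regular_nilpotent k n else 0].
  split=> [i|i j]; rewrite /mxbracket !ffunE.
    case: eqP => _; last by exists 1%N.
    exists n; rewrite regular_nilpotent_exp; apply/matrixP => a b; rewrite !mxE.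
    by rewrite ltn_eqF // (leq_trans (ltn_ord b)) // leq_addl.
  by do 2 case: eqP => _; rewrite ?mulmx0 ?mul0mx subrr.
rewrite ffunE eqxx regular_nilpotent_exp; apply/eqP.
have n1 : (n.-1 < n)%N by rewrite prednK.
move/matrixP/(_ (Ordinal n0) (Ordinal n1)); rewrite !mxE add0n eqxx => /eqP.
by rewrite oner_eq0.
Qed.

(** * The irreducibility argument *)

Lemma monomials_not_free (k : fieldType) (n r : nat) (x : mxtuple k n r)
    (m : 'I_n -> 'X_{1..r}) :
  (0 < n)%N -> (0 < r)%N -> zariski_irreducible (@nilcomm k n r) ->
  nilcomm x -> (forall i, 0 < mdeg (m i))%N ->
  ~~ row_free (\matrix_i mxvec (mx_monomial x (m i))).
Proof.
move=> n0 r0 [_ irr] hx m0; apply/negP => free.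
pose M (y : mxtuple k n r) := \matrix_i mxvec (mx_monomial y (m i)).
have full : row_full (M x)^T by rewrite /row_full mxrank_tr -/(row_free _).
(* [f] selects [n] matrix entries in which the monomials at [x] are already independent. The
   corresponding single minor, nonzero at [x], suffices to define the second closed set. *)
pose f := fullrankfun full.
pose minor := \det (\matrix_(i, j) mxvec (generic_monomial k n (m j)) 0 (f i)).
have minorE y : minor.@[mxcoord y] = \det (rowsub f (M y)^T).
  rewrite -det_map_mx; congr (\det _); apply/matrixP => i j.
  by rewrite !mxE -meval_generic_monomial -map_mxvec mxE.
pose l := Ordinal r0; pose p : 'I_n -> 'I_n -> _ :=
  fun i j => (generic_mx k n l ^+ n.-1) i j.
pose Z1 y := nilcomm y /\ zero_locus (fun q => exists i j, q = p i j) y.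
pose Z2 y := nilcomm y /\ zero_locus (eq minor) y.
case: (irr Z1 Z2).
- by exists (fun q => exists i j, q = p i j).
- by exists (eq minor).
- move=> y hy; have [y0|yN0] := eqVneq (y l ^+ n.-1) 0; [left | right].
    split=> // _ [i [j ->]].
    have := y0; rewrite -(meval_generic_mx y l) -map_mx_exp.
    by move/matrixP/(_ i j); rewrite !mxE.
  split=> // _ <-; rewrite minorE.
  (* The relation [c] among the monomials at [y] holds in the selected entries, so it is a kernel
     vector of the transposed minor matrix. *)
  have [c cN0 c0] := monomials_dependent hy yN0 m0.
  apply/eqP; rewrite -det_tr; apply/det0P; exists c => //.
  apply/rowP => j; rewrite !mxE.
  have /(congr1 (fun B => mxvec B 0 (f j))) := c0.
  rewrite linear_sum summxE linear0 mxE => {2}<-.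
  by apply: eq_bigr => i _; rewrite linearZ !mxE.
(* The tuple with a Jordan block at [l] and zeros elsewhere lies outside [Z1]. *)
- move=> Z1all; have [y hy /eqP[]] := nilcomm_regular k l n0.
  have [_ yZ] := Z1all y hy; apply/matrixP => i j.
  have := yZ (p i j) (ex_intro _ i (ex_intro _ j erefl)).
  by rewrite -[y l]meval_generic_mx -map_mx_exp !mxE.
- case/(_ x hx) => _ /(_ _ erefl); rewrite minorE => /eqP.
  have := fullrowsub_unit full; rewrite unitmxE unitfE => /negPf.
  by rewrite -/f => ->.
Qed.

(** * From dependent monomials to the dimension bound *)

(** From the end of [s], an element is kept only if its image is outside the span already obtained.
    Selecting in [T] lets basis vectors keep their exponents when [f] is [mx_monomial x]. *)
Lemma free_sublist (K : fieldType) (vT : vectType K) (T : eqType) (f : T -> vT)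
    (s : seq T) :
  exists2 t, {subset t <= s} &
    free (map f t) /\ <<map f t>>%VS = <<map f s>>%VS.
Proof.
elim: s => [|a s [t ts [ft st]]]; first by exists [::]; rewrite ?nil_free.
have [fa|fa] := boolP (f a \in <<map f s>>%VS).
  exists t => [b /ts bs|]; first by rewrite inE bs orbT.
  split=> //=; rewrite span_cons st; apply/esym/addv_idPr.
  by rewrite -memvE.
exists (a :: t) => [b|].
  by rewrite !inE => /orP[->//|/ts ->]; rewrite orbT.
by rewrite /= free_cons st fa ft !span_cons st.
Qed.

Lemma dim_monomials_lt (k : fieldType) (n r : nat) (x : mxtuple k n r)
    (s : seq 'X_{1..r}) :
  (0 < n)%N -> (0 < r)%N -> zariski_irreducible (@nilcomm k n r) ->
  nilcomm x -> all (fun m => 0 < mdeg m)%N s ->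
  (\dim <<[seq mx_monomial x m | m <- s]>> < n)%N.
Proof.
move=> n0 r0 irr hx /allP s0.
have [t ts [ft <-]] := free_sublist (mx_monomial x) s.
rewrite (eqP ft) size_map ltnNge; apply/negP => nt.
(* The first [n] monomials of the basis; since [n <= size t], the default is never reached. *)
pose m (i : 'I_n) := nth 0%MM t i.
have m0 i : (0 < mdeg (m i))%N by apply/s0/ts/mem_nth/(leq_trans (ltn_ord i)).
case/negP: (monomials_not_free n0 r0 irr hx m0).
rewrite -kermx_eq0; apply/rowV0P => c /sub_kermxP; rewrite mulmx_sum_row => c0.
have {}c0 : \sum_i c 0 i *: mx_monomial x (m i) = 0.
  apply: (can_inj mxvecK); rewrite linear_sum linear0; apply: etrans c0.
  by apply: eq_bigr => i _; rewrite linearZ rowK.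
have ftn : free (map (mx_monomial x) (take n t)).
  by move: ft; rewrite -{1}(cat_take_drop n t) map_cat => /catl_free.
have sz : size (map (mx_monomial x) (take n t)) == n.
  by rewrite size_map size_takel.
have := freeP (X := Tuple sz) ftn (fun i => c 0 i).
move=> H; apply/rowP => i; rewrite [RHS]mxE; move: i; apply: H.
rewrite -[RHS]c0; apply: eq_bigr => j _; congr (_ *: _).
by rewrite /= (nth_map 0%MM) ?nth_take // size_takel.
Qed.

Theorem corollary3p3p3 (k : closedFieldType) (n r : nat)
    (hn : (1 <= n)%N) (hr : (2 <= r)%N)
    (hirr : zariski_irreducible (@nilcomm k n r))
    (x : mxtuple k n r) (hx : nilcomm x) :
  exists U : {vspace 'M[k]_n},
    (forall y : 'M[k]_n, y \in U <-> nonunital_alg x y) /\ (\dim U <= n - 1)%N.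
Proof.
(* Finitely many exponents suffice, as monomials of degree above [r * n] vanish; the successor
   appears because the degree bound of the type is strict. *)
pose s := [seq m <- [seq val m | m : 'X_{1..r < (r * n).+1}] | (0 < mdeg m)%N].
have s0 : all (fun m => 0 < mdeg m)%N s by rewrite filter_all.
exists <<[seq mx_monomial x m | m <- s]>>%VS; split=> [y|].
  split=> [ys|[t [/allP t0]]]; first by exists s.
  apply/subvP/span_subvP => _ /mapP[m mt ->].
  have [mbig|msmall] := ltnP (r * n) (mdeg m).
    by rewrite monomial_big_eq0 ?mem0v.
  apply/memv_span/map_f; rewrite mem_filter t0 //=.
  by apply/imageP; exists (BMultinom (msmall : (mdeg m < (r * n).+1)%N)).
rewrite -ltnS subn1 prednK //.
by apply: dim_monomials_lt; rewrite // ltnW.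
Qed.
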